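(* Let $ABC$ be a triangle, and let $C_{ABC}$ be the circle symmetric, with respect to the line $(AB)$, to the circumscribed circle of the triangle $ABC$. If in the triangle $ABC$ there exist equal cevians, issuing from $A$ and from $B$, which intersect on the circle $C_{ABC}$, then the triangle $ABC$ is isosceles.
   Context: A cevian of a triangle is a segment joining a vertex of the triangle to a point that lies on the opposite side or on its extension and is different from the endpoints of that side. $(AB)$ denotes the line through the points $A$ and $B$. Everything takes place in the Euclidean plane. *)

(* Defs.v *)
From mathcomp Require Export all_boot all_order all_algebra.
From mathcomp Require Export classical_sets reals.

Set Implicit Arguments.
Unset Strict Implicit.
Unset Printing Implicit Defensive.

Import Order.TTheory GRing.Theory Num.Theory.

Local Open Scope classical_set_scope.
Local Open Scope ring_scope.

(* The Euclidean plane over R is 'rV[R]_2 with the scalar product [dot]. The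
   norm `|u| of MathComp-Analysis on row vectors is the sup norm, hence the
   separate [distance]. *)

Definition dot (R : realType) (u v : 'rV[R]_2) : R := (u *m v^T) 0 0.

Definition distance (R : realType) (P Q : 'rV[R]_2) : R :=
  Num.sqrt (dot (Q - P) (Q - P)).

Definition line (R : realType) (P Q : 'rV[R]_2) : set 'rV[R]_2 :=
  [set X | exists t : R, X = P + t *: (Q - P)].

Definition segment (R : realType) (P Q : 'rV[R]_2) : set 'rV[R]_2 :=
  [set X | exists t : R, 0 <= t <= 1 /\ X = P + t *: (Q - P)].

Definition triangle (R : realType) (A B C : 'rV[R]_2) : Prop :=
  A <> B /\ ~ line A B C.

Definition isosceles (R : realType) (A B C : 'rV[R]_2) : Prop :=
  [\/ distance A B = distance A C,
      distance B A = distance B C |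
      distance C A = distance C B].

Definition circle (R : realType) (O : 'rV[R]_2) (r : R) : set 'rV[R]_2 :=
  [set X | distance O X = r].

(* For a nondegenerate triangle exactly one circle passes through A, B and C. *)
Definition circumcircle (R : realType) (A B C : 'rV[R]_2) : set 'rV[R]_2 :=
  [set X | exists (O : 'rV[R]_2) (r : R),
     [/\ circle O r A, circle O r B, circle O r C & circle O r X]].

Definition orth_proj (R : realType) (P Q X : 'rV[R]_2) : 'rV[R]_2 :=
  P + (dot (X - P) (Q - P) / dot (Q - P) (Q - P)) *: (Q - P).

(* The symmetry with respect to line P Q: the midpoint of X and its image is
   the orthogonal projection of X. *)
Definition line_symmetry (R : realType) (P Q X : 'rV[R]_2) : 'rV[R]_2 :=
  2 *: orth_proj P Q X - X.

Definition symmetric_circle (R : realType) (A B C : 'rV[R]_2) :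
    set 'rV[R]_2 :=
  line_symmetry A B @` circumcircle A B C.

(* The segment from V to D is a cevian of the triangle V P Q, issuing from V;
   D may lie on the extension of the side P Q. *)
Definition is_cevian (R : realType) (V P Q D : 'rV[R]_2) : Prop :=
  [/\ line P Q D, D <> P & D <> Q].

(* Main.v *)
Require Import Defs.
From mathcomp Require Import ring lra.

Set Implicit Arguments.
Unset Strict Implicit.
Unset Printing Implicit Defensive.

Import Order.TTheory GRing.Theory Num.Theory.

(** Put the origin at A and write u = B - A, v = C - A, a = |BC|, b = |CA|,
    c = |AB|. Let D = B + t (C - B) and E = A + k (C - A) be the feet of the
    cevians, and X = A + s (D - A) = B + r (E - B) their common point.

    For X on the line AD, X <> A, the equation of the symmetric circle
    ([symmetric_circle_eq]) reduces to s * AD^2 = c^2 - t a^2. Together with the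
    incidence relations s t = r k and s (1 - t) = 1 - r it gives
    k b^2 + t a^2 = c^2, which says that C, D, X, E are concyclic (the
    directed angles AXB and ACB between lines are opposite). In signed lengths, the powers of A and B
    with respect to that circle are then
      s * AD^2 = AX * AD = AE * AC = k b^2,
      r * BE^2 = BX * BE = BD * BC = t a^2.
    When AD = BE, multiplying the first equation by t and the second by k
    gives t k b^2 = t k a^2 because s t = r k; since D <> B and E <> A, neither
    t nor k vanishes, and CA = CB ([equal_cevians_sides]). *)

Local Open Scope classical_set_scope.
Local Open Scope ring_scope.

Lemma dotE (R : realType) (u v : 'rV[R]_2) :
  dot u v = u 0 0 * v 0 0 + u 0 1 * v 0 1.
Proof.
rewrite /dot mxE big_ord_recl big_ord1 !mxE.
by have -> : lift ord0 ord0 = 1 :> 'I_2 by apply/val_inj.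
Qed.

Lemma dotC (R : realType) (u v : 'rV[R]_2) : dot u v = dot v u.
Proof. by rewrite !dotE; ring. Qed.

Lemma dot_linr (R : realType) (w u v : 'rV[R]_2) (a b : R) :
  dot w (a *: u + b *: v) = a * dot w u + b * dot w v.
Proof. by rewrite !dotE !mxE; ring. Qed.

Lemma dot_sqr_lin (R : realType) (u v : 'rV[R]_2) (a b : R) :
  dot (a *: u + b *: v) (a *: u + b *: v) =
  a ^+ 2 * dot u u + 2 * a * b * dot u v + b ^+ 2 * dot v v.
Proof. by rewrite !dotE !mxE; ring. Qed.

Lemma dot_ge0 (R : realType) (u : 'rV[R]_2) : 0 <= dot u u.
Proof. by rewrite dotE -!expr2 addr_ge0 ?sqr_ge0. Qed.

Lemma dot_eq0 (R : realType) (u : 'rV[R]_2) : (dot u u == 0) = (u == 0).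
Proof.
apply/eqP/eqP => [|->]; last by rewrite dotE !mxE; ring.
rewrite dotE -!expr2 => /eqP.
rewrite paddr_eq0 ?sqr_ge0 // !sqrf_eq0 => /andP[/eqP u0 /eqP u1].
apply/rowP => i; rewrite mxE; case: i => -[|[|//]] hi.
  by rewrite -[RHS]u0; congr (u _ _); apply/val_inj.
by rewrite -[RHS]u1; congr (u _ _); apply/val_inj.
Qed.

Lemma distance_eqP (R : realType) (P Q P' Q' : 'rV[R]_2) :
  distance P Q = distance P' Q' <->
  dot (Q - P) (Q - P) = dot (Q' - P') (Q' - P').
Proof.
rewrite /distance; split=> [/eqP|-> //].
by rewrite eqr_sqrt ?dot_ge0 // => /eqP.
Qed.

(** The sides AB and AC of a triangle are linearly independent vectors. *)
Lemma triangle_coord_inj (R : realType) (A B C : 'rV[R]_2) (a b a' b' : R) :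
  triangle A B C ->
  a *: (B - A) + b *: (C - A) = a' *: (B - A) + b' *: (C - A) ->
  a = a' /\ b = b'.
Proof.
move=> [AB nABC] e.
have eb : b = b'.
  apply/eqP/negPn/negP => bb'; apply: nABC.
  have d0 : b - b' != 0 by rewrite subr_eq0.
  exists ((a' - a) / (b - b')).
  have f : (b - b') *: (C - A) = (a' - a) *: (B - A).
    apply/eqP; rewrite -subr_eq0; apply/eqP.
    transitivity (a *: (B - A) + b *: (C - A)
                  - (a' *: (B - A) + b' *: (C - A))).
      by apply/rowP => i; rewrite !mxE; ring.
    by rewrite e subrr.
  by rewrite mulrC -scalerA -f scalerK // addrC subrK.
split=> //; move: e; rewrite eb => /addIr/eqP.
rewrite -subr_eq0 -scalerBl scaler_eq0 !subr_eq0 => /orP[/eqP //|/eqP BA].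
by case: AB.
Qed.

(** The projection of O on the chord AY is the midpoint of the chord. *)
Lemma equidistant_dot (R : realType) (O A Y : 'rV[R]_2) :
  distance O A = distance O Y ->
  2 * dot (O - A) (Y - A) = dot (Y - A) (Y - A).
Proof. by move=> /distance_eqP; rewrite !dotE !mxE => e; lra. Qed.

(** Equation of the symmetric circle in the affine frame (A; B - A, C - A). *)
Lemma symmetric_circle_eq (R : realType) (A B C X : 'rV[R]_2) (a b : R) :
  A <> B -> symmetric_circle A B C X ->
  X - A = a *: (B - A) + b *: (C - A) ->
  dot (X - A) (X - A) =
  a * dot (B - A) (B - A) + 2 * b * dot (B - A) (C - A)
  - b * dot (C - A) (C - A).
Proof.
move=> AB [Y [O [r [OA OB OC OY]]] XE] Xab.
have u0 : dot (B - A) (B - A) != 0.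
  by rewrite dot_eq0 subr_eq0 eq_sym; apply/eqP.
have ou := equidistant_dot (etrans OA (esym OB)).
have ov := equidistant_dot (etrans OA (esym OC)).
have oy := equidistant_dot (etrans OA (esym OY)).
move: XE; rewrite /line_symmetry /orth_proj.
set l := _ / _ => XE.
have lE : l * dot (B - A) (B - A) = dot (B - A) (Y - A).
  by rewrite /l divfK // dotC.
have Xl : X - A = (2 * l) *: (B - A) + (-1) *: (Y - A).
  by rewrite -XE; apply/rowP => i; rewrite !mxE; ring.
have xx := dot_sqr_lin (B - A) (Y - A) (2 * l) (-1).
have ox := dot_linr (O - A) (B - A) (Y - A) (2 * l) (-1).
have ux := dot_linr (B - A) (B - A) (Y - A) (2 * l) (-1).
have ox' := dot_linr (O - A) (B - A) (C - A) a b.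
have ux' := dot_linr (B - A) (B - A) (C - A) a b.
rewrite -Xl in xx ox ux; rewrite -Xab in ox' ux'.
have {}xx : dot (X - A) (X - A) = dot (Y - A) (Y - A).
  by rewrite xx -lE; ring.
have oyl : l * (2 * dot (O - A) (B - A)) = dot (B - A) (Y - A).
  by rewrite ou lE.
have oua : a * (2 * dot (O - A) (B - A)) = a * dot (B - A) (B - A).
  by rewrite ou.
have ovb : b * (2 * dot (O - A) (C - A)) = b * dot (C - A) (C - A).
  by rewrite ov.
by lra.
Qed.

(** The metric part of the argument: [c2], [w], [b2] are the entries of the Gram
    matrix of B - A and C - A, so that [c2 - 2 * w + b2] is BC^2, and [d2] is
    the common square of the lengths of the cevians. *)
Lemma equal_cevians_sides (F : fieldType) (s r t k c2 w b2 d2 : F) :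
  s != 0 -> r != 0 -> t != 0 -> k != 0 ->
  s * t = r * k -> s * (1 - t) = 1 - r ->
  d2 = (1 - t) ^+ 2 * c2 + 2 * (1 - t) * t * w + t ^+ 2 * b2 ->
  d2 = c2 - 2 * k * w + k ^+ 2 * b2 ->
  s ^+ 2 * d2 = s * (1 - t) * c2 + 2 * (s * t) * w - s * t * b2 ->
  b2 = c2 - 2 * w + b2.
Proof.
move=> s0 r0 t0 k0 st s1t dA dB circ.
set a2 := RHS.
have w2 : 2 * w = c2 + b2 - a2 by rewrite /a2; ring.
have {}dA : d2 = (1 - t) * c2 + t * b2 - t * (1 - t) * a2.
  by rewrite dA /a2; ring.
have {}dB : d2 = (1 - k) * c2 + k * a2 - k * (1 - k) * b2.
  by rewrite dB /a2; ring.
have sd : s * d2 = c2 - t * a2.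
  apply: (mulfI s0); rewrite mulrA -expr2 circ /a2; ring.
(* Concyclicity of C, D, X, E. *)
have cyc : k * b2 + t * a2 = c2.
  apply: (mulfI r0).
  have : s * d2 = (1 - r) * c2 + r * k * b2 - t * (1 - r) * a2.
    by rewrite dA -st -s1t; ring.
  rewrite sd => e.
  apply/eqP; rewrite -subr_eq0; apply/eqP.
  transitivity ((1 - r) * c2 + r * k * b2 - t * (1 - r) * a2
                - (c2 - t * a2)); first by ring.
  by rewrite -e subrr.
have powA : s * d2 = k * b2 by rewrite sd -cyc; ring.
have powB : r * d2 = t * a2.
  have r1k : r * (1 - k) = 1 - s.
    have rE : r = 1 - s * (1 - t) by rewrite s1t; ring.
    by rewrite mulrBr mulr1 -st rE; ring.
  transitivity (r * (1 - k) * c2 + r * k * a2 - k * (r * (1 - k)) * b2).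
    by rewrite dB; ring.
  by rewrite r1k -st -cyc; ring.
apply: (mulfI (mulf_neq0 t0 k0)).
transitivity (t * (s * d2)); first by rewrite powA; ring.
transitivity (s * t * d2); first by ring.
rewrite st.
transitivity (k * (r * d2)); first by ring.
by rewrite powB; ring.
Qed.

Theorem mainTheorem3 (R : realType) (A B C : 'rV[R]_2)
  (hABC : triangle A B C)
  (hcev : exists D E : 'rV[R]_2,
     [/\ is_cevian A B C D,
         is_cevian B C A E,
         distance A D = distance B E &
         exists X : 'rV[R]_2,
           [/\ segment A D X, segment B E X & symmetric_circle A B C X]]) :
  isosceles A B C.
Proof.
have [D [E [[[t DE] DB _] [[k' EE] _ EA] /distance_eqP AD_BE]]] := hcev.
move=> [X [[s [_ XD]] [r [_ XE]] circ]].
pose k := 1 - k'.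
have t0 : t != 0.
  by apply/eqP => t0; apply: DB; rewrite DE t0 scale0r addr0.
have k0 : k != 0.
  rewrite subr_eq0 eq_sym; apply/eqP => k1; apply: EA.
  by rewrite EE k1 scale1r addrC subrK.
have XD' : X - A = (s * (1 - t)) *: (B - A) + (s * t) *: (C - A).
  by rewrite XD DE; apply/rowP => i; rewrite !mxE; ring.
have XE' : X - A = (1 - r) *: (B - A) + (r * k) *: (C - A).
  by rewrite XE EE /k; apply/rowP => i; rewrite !mxE; ring.
have [s1t st] := triangle_coord_inj hABC (etrans (esym XD') XE').
have s0 : s != 0.
  apply/eqP => s0; move: st s1t; rewrite s0 !mul0r => /esym/eqP.
  rewrite mulf_eq0 (negPf k0) orbF => /eqP ->; rewrite subr0 => /eqP.
  by rewrite eq_sym oner_eq0.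
have r0 : r != 0.
  apply: contraNneq (mulf_neq0 s0 t0) => r0.
  by rewrite st r0 mul0r.
have DA : D - A = (1 - t) *: (B - A) + t *: (C - A).
  by rewrite DE; apply/rowP => i; rewrite !mxE; ring.
have EB : E - B = (-1) *: (B - A) + k *: (C - A).
  by rewrite EE /k; apply/rowP => i; rewrite !mxE; ring.
have XA : dot (X - A) (X - A) = s ^+ 2 * dot (D - A) (D - A).
  by rewrite XD !dotE !mxE; ring.
have circE := symmetric_circle_eq hABC.1 circ XD'.
apply: Or33; apply/distance_eqP.
have -> : dot (A - C) (A - C) = dot (C - A) (C - A).
  by rewrite !dotE !mxE; ring.
have -> : dot (B - C) (B - C) =
    dot (B - A) (B - A) - 2 * dot (B - A) (C - A) + dot (C - A) (C - A).
  by rewrite !dotE !mxE; ring.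
apply: (equal_cevians_sides (d2 := dot (D - A) (D - A)) s0 r0 t0 k0 st s1t).
- by rewrite DA dot_sqr_lin.
- by rewrite AD_BE EB dot_sqr_lin; ring.
- by rewrite -XA circE.
Qed.
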